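(* Let $(L,\cdot,\circ)$ be a PreLie-Com algebra. If in addition $$(x\cdot y)\circ z=x\cdot(y\circ z),\quad\forall x,y,z\in L,$$ then $(L,\cdot,[\;,\;])$ is a transposed Poisson algebra, where $[x,y]:=x\circ y-y\circ x$ for all $x,y\in L$. In particular, the conclusion holds when $(L,\cdot,\circ)$ is a differential Novikov-Poisson algebra.
   Context: All vector spaces are over a field $K$ of characteristic zero. Commutative associative algebras are not assumed unital. A pre-Lie algebra is a vector space $L$ with a bilinear operation $\circ$ satisfying $(x\circ y)\circ z-(y\circ x)\circ z=x\circ(y\circ z)-y\circ(x\circ z)$ for all $x,y,z\in L$. It is a Novikov algebra if moreover $(x\circ y)\circ z=(x\circ z)\circ y$ for all $x,y,z\in L$. A PreLie-Com algebra (pre-Lie commutative algebra) is a triple $(L,\cdot,\circ)$ where $(L,\cdot)$ is a commutative associative algebra and $(L,\circ)$ is a pre-Lie algebra satisfying $x\circ(y\cdot z)-(x\circ y)\cdot z-y\cdot(x\circ z)=0$ for all $x,y,z\in L$. A differential Novikov-Poisson algebra is a triple $(L,\cdot,\circ)$ where $(L,\cdot)$ is a commutative associative algebra and $(L,\circ)$ is a Novikov algebra satisfying, for all $x,y,z\in L$: $(x\cdot y)\circ z=x\cdot(y\circ z)$; $(x\circ y)\cdot z-(y\circ x)\cdot z=x\circ(y\cdot z)-y\circ(x\cdot z)$; and $x\circ(y\cdot z)-(x\circ y)\cdot z-y\cdot(x\circ z)=0$. A transposed Poisson algebra is a triple $(L,\cdot,[\;,\;])$ where $(L,\cdot)$ is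 a commutative associative algebra, $(L,[\;,\;])$ is a Lie algebra, and $2z\cdot[x,y]=[z\cdot x,y]+[x,z\cdot y]$ for all $x,y,z\in L$. *)

(* Defs.v *)
From mathcomp Require Import all_boot all_order all_algebra.
From mathcomp Require Import sesquilinear.

Set Implicit Arguments.
Unset Strict Implicit.
Unset Printing Implicit Defensive.

Import GRing.Theory.
Local Open Scope ring_scope.

(* An algebra is a K-module L together with operations L -> L -> L; products are
   not MathComp ring structures, since they need not have a unit and several of
   them live on the same space L. *)
Section Algebras.

Variables (K : fieldType) (L : lmodType K).
Implicit Types mul circ br : L -> L -> L.

Definition is_bilinear (f : L -> L -> L) : Prop := bilinear_for *:%R *:%R f.

Record is_com_assoc_algebra mul : Prop := IsComAssocAlgebra {
  com_assoc_bilinear : is_bilinear mul;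
  com_assoc_comm : commutative mul;
  com_assoc_assoc : associative mul }.

Record is_pre_lie_algebra circ : Prop := IsPreLieAlgebra {
  pre_lie_bilinear : is_bilinear circ;
  pre_lie_identity : forall x y z,
    circ (circ x y) z - circ (circ y x) z
    = circ x (circ y z) - circ y (circ x z) }.

Record is_novikov_algebra circ : Prop := IsNovikovAlgebra {
  novikov_pre_lie : is_pre_lie_algebra circ;
  novikov_right_comm : forall x y z, circ (circ x y) z = circ (circ x z) y }.

Record is_lie_algebra br : Prop := IsLieAlgebra {
  lie_bilinear : is_bilinear br;
  lie_alternating : forall x, br x x = 0;
  lie_jacobi : forall x y z,
    br x (br y z) + br y (br z x) + br z (br x y) = 0 }.

Record is_prelie_com_algebra mul circ : Prop := IsPreLieComAlgebra {
  prelie_com_com_assoc : is_com_assoc_algebra mul;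
  prelie_com_pre_lie : is_pre_lie_algebra circ;
  prelie_com_leibniz : forall x y z,
    circ x (mul y z) - mul (circ x y) z - mul y (circ x z) = 0 }.

Record is_differential_novikov_poisson_algebra mul circ : Prop :=
  IsDifferentialNovikovPoissonAlgebra {
  dnp_com_assoc : is_com_assoc_algebra mul;
  dnp_novikov : is_novikov_algebra circ;
  dnp_mul_circ : forall x y z, circ (mul x y) z = mul x (circ y z);
  dnp_circ_mul : forall x y z,
    mul (circ x y) z - mul (circ y x) z
    = circ x (mul y z) - circ y (mul x z);
  dnp_leibniz : forall x y z,
    circ x (mul y z) - mul (circ x y) z - mul y (circ x z) = 0 }.

Record is_transposed_poisson_algebra mul br : Prop :=
  IsTransposedPoissonAlgebra {
  tp_com_assoc : is_com_assoc_algebra mul;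
  tp_lie : is_lie_algebra br;
  tp_transposed_leibniz : forall x y z,
    2%:R *: mul z (br x y) = br (mul z x) y + br x (mul z y) }.

Definition commutator circ (x y : L) : L := circ x y - circ y x.

End Algebras.

(* Main.v *)
Require Import Defs.
From mathcomp Require Import all_boot all_order all_algebra.

Set Implicit Arguments.
Unset Strict Implicit.
Unset Printing Implicit Defensive.

Import GRing.Theory.
Local Open Scope ring_scope.

(** The commutator of a pre-Lie product is a Lie bracket
    ([commutator_is_lie_algebra]), so only the transposed Leibniz rule has to
    be checked.  Write xy for the commutative product.  Expanding
    [zx, y] + [x, zy] with the Leibniz rule for x o - and with
    (xy) o z = x(y o z) gives
    2 z[x, y] + (x o z)y - (y o z)x, and the last two terms cancel because
    (x o z)y = (yx) o z = (xy) o z = (y o z)x by commutativity.  A differential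
    Novikov-Poisson algebra satisfies all the identities used. *)

Section Commutator.

Variables (K : fieldType) (L : lmodType K).
Implicit Types mul circ : L -> L -> L.

Lemma bilinear_addl circ : is_bilinear circ ->
  forall x y z, circ (x + y) z = circ x z + circ y z.
Proof. by case=> Bl _ x y z; have := Bl z 1 x y; rewrite /= !scale1r. Qed.

Lemma bilinear_addr circ : is_bilinear circ ->
  forall x y z, circ x (y + z) = circ x y + circ x z.
Proof. by case=> _ Br x y z; have := Br x 1 y z; rewrite /= !scale1r. Qed.

Lemma bilinear_subl circ : is_bilinear circ ->
  forall x y z, circ (x - y) z = circ x z - circ y z.
Proof.
move=> B x y z; apply/eqP.
by rewrite eq_sym subr_eq -(bilinear_addl B) subrK.
Qed.

Lemma bilinear_subr circ : is_bilinear circ ->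
  forall x y z, circ x (y - z) = circ x y - circ x z.
Proof.
move=> B x y z; apply/eqP.
by rewrite eq_sym subr_eq -(bilinear_addr B) subrK.
Qed.

Lemma commutator_bilinear circ :
  is_bilinear circ -> is_bilinear (commutator circ).
Proof.
case=> Bl Br; split=> z a x y; have := Bl z a x y; have := Br z a x y.
  by rewrite /commutator /= => -> ->; rewrite scalerBr opprD addrACA.
by rewrite /commutator /= => -> ->; rewrite scalerBr opprD addrACA.
Qed.

(** The pre-Lie identity removes the left-nested products from a double
    commutator, leaving two differences of consecutive terms under the cyclic
    rotation x -> y -> z -> x. *)
Lemma commutator_commutator circ : is_pre_lie_algebra circ ->
  forall x y z,
    commutator circ x (commutator circ y z)
    = (circ x (circ y z) - circ y (circ z x))
      + (circ z (circ y x) - circ x (circ z y)).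
Proof.
case=> B PL x y z; rewrite /commutator (bilinear_subr B) (bilinear_subl B).
by rewrite opprB PL [_ - circ y _]addrC addrACA [- _ + circ z _]addrC.
Qed.

Lemma telescope_cycle (a b c : L) : (a - b) + (b - c) + (c - a) = 0.
Proof. by rewrite !subrKA subrr. Qed.

Lemma commutator_is_lie_algebra circ :
  is_pre_lie_algebra circ -> is_lie_algebra (commutator circ).
Proof.
move=> PL; split=> [|x|x y z].
- exact/commutator_bilinear/pre_lie_bilinear.
- by rewrite /commutator subrr.
rewrite !(commutator_commutator PL) [X in X + _]addrACA [LHS]addrACA.
by rewrite !telescope_cycle addr0.
Qed.

Lemma transposed_leibniz_commutator mul circ :
  is_bilinear mul -> commutative mul ->
  (forall x y z, circ x (mul y z) = mul (circ x y) z + mul y (circ x z)) ->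
  (forall x y z, circ (mul x y) z = mul x (circ y z)) ->
  forall x y z,
    2%:R *: mul z (commutator circ x y)
    = commutator circ (mul z x) y + commutator circ x (mul z y).
Proof.
move=> B C Lz M x y z.
have sym : mul (circ x z) y = mul (circ y z) x by rewrite C -M C M C.
rewrite /commutator (bilinear_subr B) !M !Lz sym scaler_nat mulr2n.
set p := mul z (circ x y); set q := mul z (circ y x); set t := mul _ x.
by rewrite [t + q]addrC opprD [p + (_ - t)]addrA -[t + p - q]addrA subrKA.
Qed.

Lemma prelie_com_transposed_poisson mul circ :
  is_prelie_com_algebra mul circ ->
  (forall x y z, circ (mul x y) z = mul x (circ y z)) ->
  is_transposed_poisson_algebra mul (commutator circ).
Proof.
case=> CA PL Lz M; split=> //; first exact: commutator_is_lie_algebra.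
case: (CA) => B C _; apply: transposed_leibniz_commutator => // x y z.
by apply/eqP; rewrite -subr_eq0 opprD addrA Lz.
Qed.

Lemma differential_novikov_poisson_prelie_com mul circ :
  is_differential_novikov_poisson_algebra mul circ ->
  is_prelie_com_algebra mul circ.
Proof. by case=> CA [PL _] _ _ Lz; split. Qed.

End Commutator.

Theorem corollary3p12 (K : fieldType) (charK0 : [pchar K]%R =i pred0)
    (L : lmodType K) (mul circ : L -> L -> L) :
  (is_prelie_com_algebra mul circ ->
   (forall x y z : L, circ (mul x y) z = mul x (circ y z)) ->
   is_transposed_poisson_algebra mul (commutator circ))
  /\
  (is_differential_novikov_poisson_algebra mul circ ->
   is_transposed_poisson_algebra mul (commutator circ)).
Proof.
split=> [|DNP]; first exact: prelie_com_transposed_poisson.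
apply: prelie_com_transposed_poisson; last exact: dnp_mul_circ DNP.
exact: differential_novikov_poisson_prelie_com.
Qed.
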